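(* Let $\beta\in\mathbb{R}_{++}$ and $r\in\{2,4,6,\ldots\}$. Let $f:\mathbb{R}\to\left]-\infty,+\infty\right]$ be given by $f(x)=\exp(-\beta x^{-r})$ for $x\neq0$ in $\big[-(\beta r/(r+1))^{1/r},(\beta r/(r+1))^{1/r}\big]$, $f(0)=0$, and $f(x)=+\infty$ outside this interval. In $\mathbb{R}^3$, let $$H:=\mathbb{R}\times\{0\}\times\mathbb{R}\quad\text{and}\quad K:=\overline{\operatorname{cone}}(\operatorname{epi} f\times\{1\}).$$ Let $\delta\in\mathbb{R}_{++}$ be such that $f$ is differentiable on $[0,\delta]$, let $b_0\in\left]0,\min\{1,\delta\}\right[$ and $a_0>0$, set $x^{(0)}:=a_0(b_0,0,1)\in H$, and generate the sequence of alternating projections by $$x^{(2n+1)}:=P_Kx^{(2n)}\quad\text{and}\quad x^{(2n+2)}:=P_Hx^{(2n+1)}\qquad(n\in\mathbb{N}).$$ Write $x^{(2n)}=a_n(b_n,0,1)$ with $a_n>0$, for $n\in\mathbb{N}$ (this is always possible). Then $$\lim_{n\to\infty}\frac{b_n}{\left(\frac{2\beta}{\ln(n)}\right)^{1/r}}=1,$$ and $$\sum_{n=0}^\infty\|x^{(n+1)}-x^{(n)}\|^\gamma=+\infty\quad\text{for all }\gamma\in\left]0,2\right[.$$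
   Context: $\mathbb{R}_{++}=\left]0,+\infty\right[$, $\mathbb{N}=\{0,1,2,\ldots\}$. $\mathbb{R}^3$ carries the Euclidean norm and is identified with $\mathbb{R}^2\times\mathbb{R}$. $\operatorname{epi} f=\{(x,y)\in\mathbb{R}\times\mathbb{R}\mid f(x)\le y\}$ is the epigraph of $f$. For a set $S$, $\overline{\operatorname{cone}}(S)$ is the closure of $\operatorname{cone}(S)=\{\alpha s\mid\alpha>0,\ s\in S\}$. For a nonempty closed convex set $S$, $P_S$ is the metric (nearest-point) projector onto $S$. *)

(* Defs.v *)
From HB Require Import structures.
From mathcomp Require Export all_boot all_order all_algebra.
From mathcomp Require Export all_classical all_reals all_analysis.
Export Order.TTheory GRing.Theory Num.Theory.
Export numFieldNormedType.Exports.

#[export] Set Implicit Arguments.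
#[export] Unset Strict Implicit.
#[export] Unset Printing Implicit Defensive.

Local Open Scope classical_set_scope.
Local Open Scope ring_scope.

(* R^3 is the product R * R * R = (R * R) * R. The product norm `|_| is the
   max-norm, hence a separate Euclidean norm; both induce the same topology,
   so [closure] has its usual meaning. *)
Definition enorm (R : realType) (u : R * R * R) : R :=
  Num.sqrt (u.1.1 ^+ 2 + u.1.2 ^+ 2 + u.2 ^+ 2).

(* The junk value u is returned only when u has no nearest point in S, which
   does not occur for S nonempty, closed and convex; for such S the nearest
   point is unique. *)
Definition metric_proj (R : realType) (S : set (R * R * R)) (u : R * R * R) :
    R * R * R :=
  xget u [set p | S p /\ forall q, S q -> enorm (u - p) <= enorm (u - q)].

Definition cone (R : realType) (S : set (R * R * R)) : set (R * R * R) :=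
  [set u | exists alpha s, [/\ 0 < alpha, S s & u = alpha *: s]].

Definition epi (R : realType) (f : R -> \bar R) : set (R * R) :=
  [set p | (f p.1 <= p.2%:E)%E].

(* Differentiability in the sense of extended-valued functions: f is finite
   near x and its real-valued restriction is differentiable at x. *)
Definition ediff_at (R : realType) (f : R -> \bar R) (x : R) : Prop :=
  (\forall y \near x, f y \is a fin_num) /\ derivable (fine \o f) x 1.

Definition dom_radius (R : realType) (beta : R) (r : nat) : R :=
  (beta * r%:R / r.+1%:R) `^ (r%:R^-1).

Definition expfun (R : realType) (beta : R) (r : nat) (x : R) : \bar R :=
  if x == 0 then 0%E
  else if x \in `[- dom_radius beta r, dom_radius beta r]%R
  then (expR (- (beta * x ^- r)))%:E
  else +oo%E.

Definition setH (R : realType) : set (R * R * R) :=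
  [set: R] `*` [set 0] `*` [set: R].
Arguments setH R : clear implicits.

Definition setK (R : realType) (beta : R) (r : nat) : set (R * R * R) :=
  closure (cone (epi (expfun beta r) `*` [set 1])).

(* Main.v *)
Require Import Defs.
From mathcomp Require Import ring lra zify.

(** Write f = exp(-beta x^-r). The optimality condition for P_K (a (b, 0, 1)) =
a' (c, f c, 1) is c + f f' (1 + b c) = b (1 + f^2), with f, f' taken at c. Since
f <= c f', it forces a' >= a and f f' <= b - c <= 2 f f'. In terms of
w = 2 beta b^-r, for which f^2 = exp(-w), consecutive terms satisfy
k exp(-w') <= w' - w <= C w'^4 exp(-w'). Hence exp(w_n) grows at least linearly,
while exp(theta w_n) grows at most linearly for every theta < 1; so w_n is
equivalent to ln n, which is the first limit. For the series, the step from K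
to H has length a_n f(b_n) >= a_0 exp(-w_n / 2), so its gamma-th power is at least
a multiple of exp(-(gamma/2) w_n), and theta = gamma/2 < 1 bounds the series
below by a harmonic one. *)

Local Open Scope classical_set_scope.
Local Open Scope ring_scope.

(** * Bernoulli's inequality and the calculus of exp(-beta x^-r) *)

Lemma bernoulli_ineq (R : realType) (u : R) (n : nat) :
  0 <= u -> 1 + n%:R * (u - 1) <= u ^+ n.
Proof.
move=> u0; elim: n => [|n IH]; first by rewrite mul0r addr0 expr0.
have n0 : 0 <= n%:R :> R by [].
have sq : 0 <= n%:R * (u - 1) ^+ 2 by rewrite mulr_ge0 ?sqr_ge0.
have := ler_wpM2l u0 IH.
rewrite -exprS -natr1; nra.
Qed.

(* As 0^-1 = 0, [expo beta r 0] is 1 whereas [expfun beta r 0] is 0. *)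
Definition expo (R : realType) (beta : R) (r : nat) (x : R) : R :=
  expR (- (beta * x ^- r)).

Definition dexpo (R : realType) (beta : R) (r : nat) (x : R) : R :=
  beta * r%:R * x ^- r.+1 * expo beta r x.

Lemma expo_gt0 (R : realType) (beta : R) (r : nat) (x : R) : 0 < expo beta r x.
Proof. exact: expR_gt0. Qed.

Lemma dexpo_gt0 (R : realType) (beta : R) (r : nat) (x : R) :
  0 < beta -> (0 < r)%N -> 0 < x -> 0 < dexpo beta r x.
Proof.
by move=> b0 r0 x0; rewrite /dexpo !mulr_gt0 ?ltr0n ?expo_gt0 ?invr_gt0 ?exprn_gt0.
Qed.

Lemma is_derive_expo (R : realType) (beta : R) (r : nat) (x : R) :
  (0 < r)%N -> x != 0 -> is_derive x 1 (expo beta r) (dexpo beta r x).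
Proof.
move=> r0 x0.
have xr0 : x ^+ r != 0 by rewrite expf_neq0.
have powE : (fun y : R => y ^+ r) = id ^+ r by rewrite exprfctE.
have d0 : is_derive x 1 (fun y : R => y ^+ r) ((r%:R * x ^+ r.-1) *: 1).
  by rewrite powE; apply: is_deriveX.
have d1 := @is_deriveV R (fun y : R => y ^+ r) x _ 1 xr0 d0.
have d2 := is_deriveN (is_deriveZ beta d1).
have d3 := is_derive1_comp (is_derive_expR _) d2.
apply: (is_derive_eq d3).
rewrite /dexpo /= /GRing.scale /=.
rewrite (_ : expR _ = expo beta r x) //.
move: (expo beta r x) => E.
case: r r0 xr0 {powE d0 d1 d2 d3} => // n _ xn0 /=.
have xn : x ^+ n != 0 by rewrite expf_neq0.
rewrite !exprS expr0; by field; rewrite x0 xn.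
Qed.

Lemma continuous_expo (R : realType) (beta : R) (r : nat) (x : R) :
  (0 < r)%N -> x != 0 -> {for x, continuous (expo beta r)}.
Proof.
move=> r0 x0; apply: differentiable_continuous; apply/derivable1_diffP.
by have [] := is_derive_expo beta r0 x0.
Qed.

(* The extremal case y^r (r+1) = beta r is the inflection point of [expo]. *)
Lemma dexpo_le (R : realType) (beta : R) (r : nat) (x y : R) :
  0 < beta -> (0 < r)%N -> 0 < x -> x <= y ->
  y ^+ r * r.+1%:R <= beta * r%:R -> dexpo beta r x <= dexpo beta r y.
Proof.
move=> b0 r0 x0 xy yr.
have y0 : 0 < y by exact: lt_le_trans xy.
have rR : 0 < r%:R :> R by rewrite ltr0n.
(* Taking logarithms turns the claim into (r+1) (ln y - ln x) <= beta (x^-r - y^-r), which is [key].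
   It follows from ln (Y/X) <= Y/X - 1 and (r+1)/r <= beta/Y. *)
rewrite /dexpo -!mulrA !ler_pM2l // /expo -[x ^- _]lnK ?posrE ?invr_gt0 ?exprn_gt0 //.
rewrite -[y ^- r.+1]lnK ?posrE ?invr_gt0 ?exprn_gt0 // -!expRD ler_expR.
rewrite !lnV ?posrE ?exprn_gt0 // !lnXn //.
set X := x ^+ r; set Y := y ^+ r.
have X0 : 0 < X by rewrite exprn_gt0.
have Y0 : 0 < Y by rewrite exprn_gt0.
have XY : X <= Y by rewrite lerXn2r // nnegrE ltW.
have lnXY : r%:R * (ln y - ln x) = ln (Y / X).
  by rewrite ln_div ?posrE // /X /Y !lnXn // mulrBr !mulr_natl.
have lnle : ln (Y / X) <= Y / X - 1.
  have := @le_ln1Dx R (Y / X - 1); rewrite addrCA subrr addr0; apply.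
  by rewrite ltrBrDl subrr divr_gt0.
have Y1 : r.+1%:R / r%:R <= beta / Y.
  by rewrite ler_pdivlMr // mulrAC ler_pdivrMr // mulrC.
have YX1 : 0 <= Y / X - 1 by rewrite subr_ge0 ler_pdivlMr // mul1r.
have key : r.+1%:R * (ln y - ln x) <= beta / X - beta / Y.
  have -> : beta / X - beta / Y = beta / Y * (Y / X - 1).
    by field; rewrite ?gt_eqF.
  apply: le_trans (ler_wpM2r YX1 Y1).
  have -> : ln y - ln x = ln (Y / X) / r%:R.
    by rewrite -lnXY mulrC mulKf // gt_eqF.
  by rewrite mulrA mulrAC ler_wpM2l // divr_ge0 // ltW.
rewrite -[ln x *+ _]mulr_natl -[ln y *+ _]mulr_natl.
move: key; move: (ln x) (ln y) (beta / X) (beta / Y) r.+1%:R => lx ly p q n.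
by rewrite mulrBr; lra.
Qed.

(** This is convexity up to the inflection point: the mean value theorem gives the slope of the
    chord as [dexpo] at an intermediate point, and [dexpo_le] compares it with the slope at c. *)
Lemma expo_ge_tangent (R : realType) (beta : R) (r : nat) (c s : R) :
  0 < beta -> (0 < r)%N -> 0 < c -> 0 < s ->
  c ^+ r * r.+1%:R <= beta * r%:R -> s ^+ r * r.+1%:R <= beta * r%:R ->
  expo beta r c + dexpo beta r c * (s - c) <= expo beta r s.
Proof.
move=> b0 r0 c0 s0 cr sr.
have mvt x y : 0 < x -> x < y -> exists2 z, x <= z <= y &
    expo beta r y - expo beta r x = dexpo beta r z * (y - x).
  move=> x0 xy; have := @MVT R (expo beta r) (dexpo beta r) x y xy.
  case.
  - move=> z; rewrite in_itv /= => /andP[xz _].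
    by apply: is_derive_expo => //; rewrite gt_eqF // (lt_trans x0).
  - apply: continuous_in_subspaceT => z; rewrite inE /= in_itv /= => /andP[xz _].
    by apply: continuous_expo => //; rewrite gt_eqF // (lt_le_trans x0).
  - by move=> z; rewrite in_itv /= => /andP[xz zy] E; exists z; rewrite ?ltW.
have [cs|sc|->] := ltgtP c s; last by rewrite subrr mulr0 addr0.
- have [z /andP[cz zs] E] := mvt _ _ c0 cs.
  have zr : z ^+ r * r.+1%:R <= beta * r%:R.
    apply: le_trans sr; rewrite ler_wpM2r // lerXn2r // nnegrE ?ltW //.
    exact: lt_le_trans cz.
  have := dexpo_le b0 r0 c0 cz zr; have : 0 < s - c by rewrite subr_gt0.
  move: E; move: (expo _ _ _) (expo _ _ _) (dexpo _ _ _) (dexpo _ _ _) => fs fc dc dz.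
  by nra.
- have [z /andP[sz zc] E] := mvt _ _ s0 sc.
  have := dexpo_le b0 r0 (lt_le_trans s0 sz) zc cr.
  have : 0 < c - s by rewrite subr_gt0.
  move: E; move: (expo _ _ _) (expo _ _ _) (dexpo _ _ _) (dexpo _ _ _) => fs fc dc dz.
  by nra.
Qed.

(** The quotient c f'(c) / f(c) is beta r c^-r, which is at least r + 1 on the domain. *)
Lemma expo_le_dexpo (R : realType) (beta : R) (r : nat) (c : R) :
  0 < beta -> 0 < c -> c ^+ r * r.+1%:R <= beta * r%:R ->
  expo beta r c <= c * dexpo beta r c.
Proof.
move=> b0 c0 cr.
have -> : c * dexpo beta r c = beta * r%:R / c ^+ r * expo beta r c.
  by rewrite /dexpo exprS; field; rewrite !gt_eqF ?exprn_gt0.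
apply: ler_peMl; first exact/ltW/expo_gt0.
rewrite ler_pdivlMr ?exprn_gt0 // mul1r; apply: le_trans cr.
by rewrite ler_peMr ?ler1n // exprn_ge0 // ltW.
Qed.

(** With t = beta c^-r, the bound t exp(-t) <= 1 is squared, and c^r <= c^2 does the rest. The
    linear bound in c gives a sign at the left end of the interval in [step_exists]. *)
Lemma expo_dexpo_small (R : realType) (beta : R) (r : nat) (c : R) :
  0 < beta -> (1 < r)%N -> 0 < c <= 1 ->
  expo beta r c * dexpo beta r c <= r%:R / beta * c.
Proof.
move=> b0 r1 /andP[c0 c1].
set X := c ^- r; have X0 : 0 < X by rewrite invr_gt0 exprn_gt0.
have bX0 : 0 < beta * X by rewrite mulr_gt0.
have r0 : 0 < r%:R :> R by rewrite ltr0n ltnW.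
have FX : expo beta r c * (beta * X) <= 1.
  rewrite /expo expRN -/X mulrC ler_pdivrMr ?expR_gt0 // mul1r.
  by have := expR_ge1Dx (beta * X); lra.
have FX2 : (expo beta r c * (beta * X)) ^+ 2 <= 1.
  by rewrite exprn_ile1 // ltW // mulr_gt0 ?expo_gt0.
have -> : expo beta r c * dexpo beta r c =
    (expo beta r c * (beta * X)) ^+ 2 * (r%:R / (beta * c) / X).
  rewrite /dexpo -/X exprS invfM -/X; field; by rewrite !gt_eqF.
apply: (@le_trans _ _ (1 * (r%:R / (beta * c) / X))).
  by rewrite ler_wpM2r // !divr_ge0 ?mulr_ge0 ?ltW.
have Xc : X^-1 <= c ^+ 2 by rewrite /X invrK; apply: ler_wiXn2l => //; exact: ltW.
have -> : r%:R / beta * c = r%:R / (beta * c) * c ^+ 2.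
  by field; rewrite !gt_eqF.
by rewrite mul1r ler_wpM2l // divr_ge0 ?mulr_ge0 ?ltW.
Qed.

(** * The optimality equation: solvability and size of the step *)

(** The intermediate value theorem is applied to the difference [phi] of the two sides, away from 0,
    where [expo] need not be continuous. *)
Lemma step_exists (R : realType) (beta : R) (r : nat) (b : R) :
  0 < beta -> (1 < r)%N -> 0 < b < 1 -> b ^+ r * r.+1%:R <= beta * r%:R ->
  exists2 c, 0 < c < b &
    c + expo beta r c * dexpo beta r c * (1 + b * c) =
    b * (1 + expo beta r c ^+ 2).
Proof.
move=> be0 r1 /andP[b0 b1] br.
have r0 : (0 < r)%N by exact: ltnW.
pose phi c := c + expo beta r c * dexpo beta r c * (1 + b * c) -
  b * (1 + expo beta r c ^+ 2).
pose k := r%:R / beta.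
have k0 : 0 < k by rewrite divr_gt0 ?ltr0n.
(* Chosen so that c0 (1 + 2k) = b/2: since f f' (1 + b c0) <= 2 k c0 at c0, this gives phi(c0) < b/2
   - b < 0. *)
pose c0 := b / (2 * (1 + 2 * k)).
have den0 : 0 < 2 * (1 + 2 * k) by lra.
have c00 : 0 < c0 by rewrite divr_gt0.
have c0E : c0 * (2 * (1 + 2 * k)) = b by rewrite divfK ?gt_eqF.
have c0b : c0 < b by nra.
have phi0 : phi c0 < 0.
  have c01 : 0 < c0 <= 1 by rewrite c00 /=; lra.
  have H := expo_dexpo_small be0 r1 c01; rewrite -/k in H; rewrite /phi.
  have F0 : 0 < expo beta r c0 by exact: expo_gt0.
  have D0 := dexpo_gt0 be0 r0 c00.
  have A0 := mulr_gt0 F0 D0.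
  have G : expo beta r c0 * dexpo beta r c0 * (1 + b * c0) <= k * c0 * 2.
    by apply: ler_pM => //; [exact: ltW|nra|nra].
  have : 0 < b * expo beta r c0 ^+ 2 by rewrite mulr_gt0 ?exprn_gt0.
  by move: c0E; nra.
(* Here phi(b) = f f' (1 + b^2) - b f^2, and f <= b f' leaves at least f f'. *)
have phib : 0 < phi b.
  have := expo_le_dexpo be0 b0 br; rewrite /phi.
  have := dexpo_gt0 be0 r0 b0; have := expo_gt0 beta r b.
  move: (expo _ _ _) (dexpo _ _ _) => F D F0 D0 FD.
  have := ler_wpM2l (ltW (mulr_gt0 b0 F0)) FD.
  have := mulr_gt0 F0 D0; nra.
have cphi x : 0 < x -> {for x, continuous phi}.
  move=> x0; have xn0 : x != 0 by rewrite gt_eqF.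
  have cF := @continuous_expo R beta r x r0 xn0.
  have cX : {for x, continuous (fun y : R => y ^- r.+1)}.
    by apply: cvgV; [rewrite expf_neq0|exact: exprn_continuous].
  have cD : {for x, continuous (dexpo beta r)}.
    by apply: cvgM => //; apply: cvgM => //; exact: cvg_cst.
  apply: cvgB; last first.
    apply: cvgM; first exact: cvg_cst.
    apply: cvgD; first exact: cvg_cst.
    by rewrite expr2; apply: cvgM.
  apply: cvgD; first exact: cvg_id.
  apply: cvgM; first exact: cvgM.
  apply: cvgD; first exact: cvg_cst.
  by apply: cvgM; [exact: cvg_cst|exact: cvg_id].
have [c] : exists2 c, c \in `[c0, b]%R & phi c = 0.
  apply: IVT; first exact: ltW.
  - apply: continuous_in_subspaceT => z; rewrite inE /= in_itv /= => /andP[cz _].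
    by apply: cphi; exact: lt_le_trans cz.
  - by rewrite ge_min le_max (ltW phi0) (ltW phib) orbT.
rewrite in_itv /= => /andP[c0c cb] phic; exists c; last exact: subr0_eq.
rewrite (lt_le_trans c00) //= lt_neqAle cb andbT.
by apply/eqP => E; move: phib; rewrite -E phic ltxx.
Qed.

(** The equation reads b - c = f f' (1 + b c) - b f^2, where 0 <= b f^2 <= b c f f' and b c < 1. *)
Lemma step_bounds (R : realType) (beta : R) (r : nat) (b c : R) :
  0 < beta -> (0 < r)%N -> 0 < c < b -> b < 1 -> c ^+ r * r.+1%:R <= beta * r%:R ->
  c + expo beta r c * dexpo beta r c * (1 + b * c) =
    b * (1 + expo beta r c ^+ 2) ->
  expo beta r c * dexpo beta r c <= b - c <= 2 * (expo beta r c * dexpo beta r c).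
Proof.
move=> be0 r0 /andP[c0 cb] b1 cr.
have := expo_le_dexpo be0 c0 cr; have := dexpo_gt0 be0 r0 c0.
have := expo_gt0 beta r c.
move: (expo _ _ _) (dexpo _ _ _) => F D F0 D0 FD E.
have A0 := mulr_gt0 F0 D0.
have bF : 0 < b * F by rewrite mulr_gt0 // (lt_trans c0).
have H1 := ler_wpM2l (ltW bF) FD.
have H2 : F * D * (b * c) <= F * D * 1 by rewrite ler_pM2l //; nra.
have H3 : 0 <= b * F ^+ 2 by rewrite mulr_ge0 ?sqr_ge0 // ltW // (lt_trans c0).
by apply/andP; split; nra.
Qed.

(** * The projections onto H and K *)

(* The hypothesis is the obtuse-angle criterion, which is sufficient for p to
   be the unique nearest point even when S is not convex. *)
Lemma metric_proj_obtuse (R : realType) (S : set (R * R * R)) (u p : R * R * R) :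
  S p ->
  (forall q, S q -> (u.1.1 - p.1.1) * (q.1.1 - p.1.1) +
    (u.1.2 - p.1.2) * (q.1.2 - p.1.2) + (u.2 - p.2) * (q.2 - p.2) <= 0) ->
  metric_proj S u = p.
Proof.
move=> Sp ang; apply: xget_unique.
  split=> // q Sq; rewrite /enorm ler_sqrt; last by rewrite !addr_ge0 ?sqr_ge0.
  have := ang q Sq.
  have := sqr_ge0 (q.1.1 - p.1.1); have := sqr_ge0 (q.1.2 - p.1.2).
  have := sqr_ge0 (q.2 - p.2).
  case: u q p {Sp ang Sq} => [[u1 u2] u3] [[q1 q2] q3] [[p1 p2] p3] /=.
  by nra.
move=> q [Sq qmin].
have := qmin p Sp; rewrite /enorm ler_sqrt; last by rewrite !addr_ge0 ?sqr_ge0.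
have := ang q Sq.
case: u q p {Sp ang Sq qmin} => [[u1 u2] u3] [[q1 q2] q3] [[p1 p2] p3] /= A B.
have s1 := sqr_ge0 (q1 - p1); have s2 := sqr_ge0 (q2 - p2).
have s3 := sqr_ge0 (q3 - p3).
have Z : (q1 - p1) ^+ 2 + (q2 - p2) ^+ 2 + (q3 - p3) ^+ 2 <= 0 by nra.
have zero (x : R) : x ^+ 2 <= 0 -> x = 0.
  by move=> x0; apply/eqP; rewrite -sqrf_eq0 eq_le x0 sqr_ge0.
congr ((_, _), _); apply/subr0_eq/zero; lra.
Qed.

Lemma metric_proj_setH (R : realType) (u : R * R * R) :
  metric_proj (setH R) u = (u.1.1, 0, u.2).
Proof.
apply: metric_proj_obtuse => //= q [[_ ->] _].
by rewrite !subrr !(mul0r, mulr0) !addr0.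
Qed.

(** It trades the r-th root for a polynomial inequality, the form in which membership in the domain
    is carried through the proof. *)
Lemma le_dom_radius (R : realType) (beta : R) (r : nat) (x : R) :
  0 < beta -> (0 < r)%N -> 0 <= x ->
  (x <= dom_radius beta r) = (x ^+ r * r.+1%:R <= beta * r%:R).
Proof.
move=> be0 r0 x0; rewrite -ler_pdivlMr ?ltr0n //.
have M0 : 0 <= dom_radius beta r by exact: powR_ge0.
rewrite -(@ler_pXn2r _ r) ?nnegrE // /dom_radius.
rewrite -[X in _ <= X]powR_mulrn ?powR_ge0 // -powRrM mulVf ?pnatr_eq0 -?lt0n //.
by rewrite powRr1 // divr_ge0 ?mulr_ge0 // ltW.
Qed.

Lemma expfunE (R : realType) (beta : R) (r : nat) (c : R) :
  0 < beta -> (0 < r)%N -> 0 < c -> c ^+ r * r.+1%:R <= beta * r%:R ->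
  expfun beta r c = (expo beta r c)%:E.
Proof.
move=> be0 r0 c0 cr; rewrite /expfun gt_eqF // in_itv /= (le_dom_radius be0 r0 (ltW c0)).
rewrite cr andbT ifT // (le_trans _ (ltW c0)) // oppr_le0; exact: powR_ge0.
Qed.

Lemma expfun_le (R : realType) (beta : R) (r : nat) (s y : R) :
  0 < beta -> (0 < r)%N -> (expfun beta r s <= y%:E)%E ->
  0 <= y /\ (0 < s -> s ^+ r * r.+1%:R <= beta * r%:R /\ expo beta r s <= y).
Proof.
move=> be0 r0; rewrite /expfun; case: eqVneq => [->|s0].
  by rewrite lee_fin => y0; rewrite ltxx.
case: ifPn; last by rewrite leye_eq.
rewrite in_itv /= lee_fin => /andP[_ sM] Fy; split.
  by apply: le_trans Fy; exact: expR_ge0.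
by move=> s_gt0; rewrite -(le_dom_radius be0 r0 (ltW s_gt0)).
Qed.

(* (f'(c), -1, f(c) - c f'(c)) is an outer normal of K along the ray through
   (c, f(c), 1). *)
Lemma setK_supporting (R : realType) (beta : R) (r : nat) (c : R) (q : R * R * R) :
  0 < beta -> (0 < r)%N -> 0 < c -> c ^+ r * r.+1%:R <= beta * r%:R ->
  setK beta r q ->
  dexpo beta r c * q.1.1 - q.1.2 + (expo beta r c - c * dexpo beta r c) * q.2 <= 0.
Proof.
move=> be0 r0 c0 cr.
pose g (q : R * R * R) := dexpo beta r c * q.1.1 - q.1.2 +
  (expo beta r c - c * dexpo beta r c) * q.2.
(* The half-space is closed, so the inequality need only be tested on the cone before closure. *)
have clg : closed (g @^-1` [set x | x <= 0]).
  apply: preimage_closed; last exact: closed_le.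
  move=> x _; rewrite /g.
  have c1 : {for x, continuous (fun q : R * R * R => q.1.1)}.
    by apply: cvg_comp; [exact: cvg_fst|exact: cvg_fst].
  have c2 : {for x, continuous (fun q : R * R * R => q.1.2)}.
    by apply: cvg_comp; [exact: cvg_fst|exact: cvg_snd].
  have c3 : {for x, continuous (fun q : R * R * R => q.2)} by exact: cvg_snd.
  apply: cvgD; last by apply: cvgM; [exact: cvg_cst|exact: c3].
  by apply: cvgB; [apply: cvgM; [exact: cvg_cst|exact: c1]|exact: c2].
have sub : cone (epi (expfun beta r) `*` [set 1]) `<=` g @^-1` [set x | x <= 0].
  move=> _ [al [[[s y] z]] [al0 [/= Hsy ->] ->]]; rewrite /g /=.
  have /= [y0 Hs] := expfun_le be0 r0 Hsy.
  have D0 := dexpo_gt0 be0 r0 c0.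
  have FD := expo_le_dexpo be0 c0 cr.
  rewrite -[X in X <= _](_ : al * (dexpo beta r c * s - y +
     (expo beta r c - c * dexpo beta r c)) = _); last first.
    by rewrite /GRing.scale /=; ring.
  rewrite pmulr_rle0 //.
  (* For s <= 0 each of the three terms is nonpositive, by y >= 0 and f(c) <= c f'(c); for s > 0 the
     tangent inequality applies. *)
  have [s0|s0] := leP s 0.
    have : dexpo beta r c * s <= 0 by rewrite pmulr_rle0.
    lra.
  have [sr Fs] := Hs s0.
  have := expo_ge_tangent be0 r0 c0 s0 cr sr; lra.
have : closure (cone (epi (expfun beta r) `*` [set 1])) `<=` g @^-1` [set x | x <= 0].
  by rewrite [X in _ `<=` X](closure_id _).1 //; exact: closureS.
by move=> /(_ q).
Qed.

(** The optimality equation makes u - p a positive multiple of the normal (f', -1, f - c f') at p,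
    so [setK_supporting] yields the obtuse-angle criterion. *)
Lemma metric_proj_setK (R : realType) (beta : R) (r : nat) (a b c : R) :
  0 < beta -> (0 < r)%N -> 0 < a -> 0 < b -> 0 < c ->
  c ^+ r * r.+1%:R <= beta * r%:R ->
  c + expo beta r c * dexpo beta r c * (1 + b * c) =
    b * (1 + expo beta r c ^+ 2) ->
  exists2 a', a <= a' &
    metric_proj (setK beta r) (a *: (b, 0, 1)) = a' *: (c, expo beta r c, 1).
Proof.
move=> be0 r0 a0 b0 c0 cr E.
have F0 := expo_gt0 beta r c; have D0 := dexpo_gt0 be0 r0 c0.
have FD := expo_le_dexpo be0 c0 cr.
have supp := fun q => @setK_supporting R beta r c q be0 r0 c0 cr.
have Kp al : 0 < al -> setK beta r (al *: (c, expo beta r c, 1)).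
  move=> al0; apply: subset_closure; exists al, (c, expo beta r c, 1); split=> //.
  by split=> //; rewrite /epi /= expfunE.
move: (expo _ _ _) (dexpo _ _ _) E F0 D0 FD supp Kp => F D E F0 D0 FD supp Kp.
(* The third coordinate of u - p = al F (D, -1, F - c D) forces a = al d. The equation gives b d = c
   + F D > 0, and F <= c D gives d <= 1, hence al >= a. *)
pose d := 1 + F ^+ 2 - c * F * D.
have d0 : 0 < d.
  have : 0 < b * d by rewrite /d; have := mulr_gt0 F0 D0; nra.
  by rewrite pmulr_rgt0.
have d1 : d <= 1 by rewrite /d; nra.
pose al := a / d.
have ald : al * d = a by rewrite divfK // gt_eqF.
have al0 : 0 < al by rewrite divr_gt0.
exists al; first by rewrite -{1}ald ger_pMr.
apply: metric_proj_obtuse; first exact: Kp.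
move=> q /supp; case: q => [[q1 q2] q3] /= Hq.
rewrite /GRing.scale /= !mulr1 mulr0.
have e1 : a * b - al * c = al * F * D.
  have -> : a * b = al * (b * d) by rewrite -ald; ring.
  have -> : b * d = c + F * D by rewrite /d; lra.
  by ring.
have e3 : a - al = al * F * (F - c * D) by rewrite -ald /d; ring.
rewrite e1 e3.
have -> : al * F * D * (q1 - al * c) + (0 - al * F) * (q2 - al * F) +
   al * F * (F - c * D) * (q3 - al) =
   al * F * (D * q1 - q2 + (F - c * D) * q3) by ring.
by rewrite pmulr_rle0 // mulr_gt0.
Qed.

(** * The recurrence in the variable w = 2 beta b^-r *)

Definition rate (R : realType) (beta : R) (r : nat) (b : R) : R :=
  2 * beta * b ^- r.

Lemma rate_ge0 (R : realType) (beta : R) (r : nat) (b : R) :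
  0 < beta -> 0 < b -> 0 <= rate beta r b.
Proof. by move=> be0 b0; rewrite /rate !mulr_ge0 ?invr_ge0 ?exprn_ge0 // ltW. Qed.

Lemma expo_powR (R : realType) (beta : R) (r : nat) (b gamma : R) :
  expo beta r b `^ gamma = expR (- (gamma / 2 * rate beta r b)).
Proof. by rewrite /expo -expRM /rate; move: (b ^- r) => z; congr expR; field. Qed.

Lemma expo_dexpoE (R : realType) (beta : R) (r : nat) (c : R) :
  expo beta r c * dexpo beta r c =
  beta * r%:R * c ^- r.+1 * expR (- rate beta r c).
Proof.
have -> : expR (- rate beta r c) = expo beta r c * expo beta r c.
  by rewrite /expo -expRD /rate; congr expR; ring.
by rewrite /dexpo; ring.
Qed.

(** Bernoulli's inequality at c/b and at b/c bounds c^-r - b^-r above and below by multiples of b -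
    c, and [expo_dexpoE] expresses the bounds on b - c through exp(-w'). *)
Lemma rate_step (R : realType) (beta : R) (r : nat) (b c : R) :
  0 < beta -> (0 < r)%N -> 0 < c < b -> b < 1 ->
  expo beta r c * dexpo beta r c <= b - c <= 2 * (expo beta r c * dexpo beta r c) ->
  2 * beta ^+ 2 * r%:R ^+ 2 * expR (- rate beta r c) <=
    rate beta r c - rate beta r b <=
    4 * beta ^+ 2 * r%:R ^+ 2 / (2 * beta) ^+ 4 * rate beta r c ^+ 4 *
    expR (- rate beta r c).
Proof.
move=> be0 r0 /andP[c0 cb] b1; rewrite expo_dexpoE.
set E := expR _; have E0 : 0 < E by exact: expR_gt0.
have b0 := lt_trans c0 cb; have c1 := lt_trans cb b1.
have rR : 0 < r%:R :> R by rewrite ltr0n.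
have Xn0 (n : nat) (y : R) : 0 < y -> 0 < y ^- n by move=> ?; rewrite invr_gt0 exprn_gt0.
have ge1 (n : nat) (y : R) : 0 < y < 1 -> 1 <= y ^- n.
  by move=> /andP[y0 y1]; rewrite invf_ge1 ?exprn_gt0 // exprn_ile1 // ltW.
set V := c ^- r.+1; have V1 : 1 <= V by apply: ge1; rewrite c0.
have V0 := lt_le_trans ltr01 V1.
have bc0 : 0 < b - c by rewrite subr_gt0.
move=> /andP[lo hi].
have VE : V = c ^- r / c by rewrite /V exprS invfM mulrC.
have up : c ^- r - b ^- r <= r%:R * V * (b - c).
  have H := @bernoulli_ineq R (c / b) r (ltW (divr_gt0 c0 b0)).
  have := ler_wpM2l (ltW (Xn0 r c c0)) H.
  have -> : c ^- r * (c / b) ^+ r = b ^- r.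
    by rewrite expr_div_n mulrA mulVf ?mul1r // gt_eqF // exprn_gt0.
  have G : r%:R * (c ^- r * ((b - c) / b)) <= r%:R * (c ^- r * ((b - c) / c)).
    rewrite ler_pM2l // ler_pM2l ?Xn0 // ler_pM2l // lef_pV2 ?posrE //.
    exact: ltW.
  have -> : c / b - 1 = - ((b - c) / b) by field; rewrite gt_eqF.
  have -> : r%:R * V * (b - c) = r%:R * (c ^- r * ((b - c) / c)).
    by rewrite VE; ring.
  by move: G; lra.
(* The factors b^-r and 1/c, both at least 1, are dropped. *)
have low : r%:R * (b - c) <= c ^- r - b ^- r.
  have H := @bernoulli_ineq R (b / c) r (ltW (divr_gt0 b0 c0)).
  have := ler_wpM2l (ltW (Xn0 r b b0)) H.
  have -> : b ^- r * (b / c) ^+ r = c ^- r.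
    by rewrite expr_div_n mulrA mulVf ?mul1r // gt_eqF // exprn_gt0.
  have -> : b / c - 1 = (b - c) / c by field; rewrite gt_eqF.
  have bc : b - c <= (b - c) / c by rewrite ler_peMr ?invf_ge1 // ltW.
  have B1 : 1 <= b ^- r by apply: ge1; rewrite b0.
  have H1 : (b - c) <= b ^- r * ((b - c) / c).
    apply: le_trans bc _; apply: ler_peMl => //.
    by rewrite divr_ge0 // ltW.
  have := ler_wpM2l (ltW rR) H1; lra.
have -> : rate beta r c - rate beta r b = 2 * beta * (c ^- r - b ^- r).
  by rewrite /rate; ring.
have tb0 : 0 < 2 * beta by rewrite mulr_gt0.
apply/andP; split.
  have -> : 2 * beta ^+ 2 * r%:R ^+ 2 * E = 2 * beta * (r%:R * (beta * r%:R * 1 * E)).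
    by ring.
  rewrite ler_pM2l //; apply: le_trans low; rewrite ler_pM2l //.
  apply: le_trans lo; rewrite ler_pM2r // ler_pM2l // mulr_gt0 //.
(* For c < 1 and r >= 1, 2 (r + 1) <= 4 r gives c^(-2(r+1)) <= c^(-4r); this is the origin of the
   fourth power of the rate. *)
have V2 : V ^+ 2 <= (c ^- r) ^+ 4.
  rewrite /V -!exprVn -!exprM; apply: ler_weXn2l; first by rewrite invf_ge1 // ltW.
  by move: r0; clear; case: r => // n _; rewrite !mulnS !muln0; lia.
apply: (@le_trans _ _ (2 * beta * (r%:R * V * (2 * (beta * r%:R * V * E))))).
  rewrite ler_pM2l //; apply: le_trans up _.
  by rewrite ler_pM2l // mulr_gt0.
have -> : 2 * beta * (r%:R * V * (2 * (beta * r%:R * V * E))) =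
    4 * beta ^+ 2 * r%:R ^+ 2 * E * V ^+ 2 by ring.
have -> : 4 * beta ^+ 2 * r%:R ^+ 2 / (2 * beta) ^+ 4 * rate beta r c ^+ 4 * E =
    4 * beta ^+ 2 * r%:R ^+ 2 * E * (c ^- r) ^+ 4.
  rewrite /rate; move: (c ^- r) => z; field; rewrite gt_eqF //.
by rewrite ler_wpM2l // !mulr_ge0 ?sqr_ge0 // ltW.
Qed.

(** * Growth of exp(w_n) from the recurrence, and w_n compared with ln n *)

(** This is t <= exp(t) at t = e w / 4, raised to the fourth power. *)
Lemma pow4_expRN_le (R : realType) (e w : R) :
  0 < e -> 0 <= w -> w ^+ 4 * expR (- (e * w)) <= (4 / e) ^+ 4.
Proof.
move=> e0 w0; rewrite expRN ler_pdivrMr ?expR_gt0 //.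
have -> : expR (e * w) = expR (e * w / 4) ^+ 4.
  by rewrite -expRM_natr; congr expR; field.
rewrite -exprMn; apply: lerXn2r; rewrite ?nnegrE //.
  by rewrite mulr_ge0 ?expR_ge0 // divr_ge0 // ltW.
have : e * w / 4 <= expR (e * w / 4).
  by have := expR_ge1Dx (e * w / 4); lra.
rewrite -(@ler_pM2l _ (4 / e)) ?divr_gt0 //.
by have -> : 4 / e * (e * w / 4) = w by field; rewrite gt_eqF.
Qed.

(** The increment of exp(theta w) is at most theta (w' - w) exp(theta w') <= theta C w'^4 exp(-(1 -
    theta) w'), which is bounded because theta < 1. *)
Lemma expR_rate_upper (R : realType) (w : nat -> R) (C theta : R) :
  (forall n, 0 <= w n) -> 0 <= C -> 0 < theta < 1 ->
  (forall n, w n.+1 - w n <= C * w n.+1 ^+ 4 * expR (- w n.+1)) ->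
  exists2 C1, 0 < C1 & forall n, expR (theta * w n) <= C1 * n.+1%:R.
Proof.
move=> w0 C0 /andP[t0 t1] H.
have e0 : 0 < 1 - theta by lra.
pose B := theta * (C * (4 / (1 - theta)) ^+ 4).
have B0 : 0 <= B.
  apply: mulr_ge0; first exact: ltW.
  apply: mulr_ge0 => //; apply: exprn_ge0; apply: divr_ge0 => //; exact: ltW.
have step n : expR (theta * w n.+1) - expR (theta * w n) <= B.
  have E0 := expR_gt0 (theta * w n.+1).
  have D := ler_wpM2l (ltW t0) (H n).
  have -> : expR (theta * w n) =
      expR (theta * w n.+1) * expR (- (theta * (w n.+1 - w n))).
    by rewrite -expRD; congr expR; ring.
  have L := ler_wpM2l (ltW E0) (expR_ge1Dx (- (theta * (w n.+1 - w n)))).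
  have U := ler_wpM2l (ltW E0) D.
  have P := ler_wpM2l (mulr_ge0 (ltW t0) C0) (pow4_expRN_le e0 (w0 n.+1)).
  have EE : expR (theta * w n.+1) * expR (- w n.+1) =
      expR (- ((1 - theta) * w n.+1)).
    by rewrite -expRD; congr expR; ring.
  rewrite -EE in P; rewrite /B; move: L U P.
  move: (expR _) (expR _) (expR _) (_ ^+ 4) (_ ^+ 4) => x y z p q; lra.
exists (expR (theta * w 0%N) + B); first by rewrite ltr_wpDr ?expR_gt0.
elim=> [|n IH]; first by rewrite mulr1; lra.
have := step n; rewrite -[n.+2%:R]natr1.
have := expR_gt0 (theta * w 0%N); move: IH; lra.
Qed.

(** The increment of exp(w) is at least (w' - w) exp(w) >= k exp(w - w'). The upper bound on the
    steps gives w' - w <= B, so this is at least k exp(-B). *)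
Lemma expR_rate_lower (R : realType) (w : nat -> R) (C k : R) :
  (forall n, 0 <= w n) -> 0 <= C -> 0 < k ->
  (forall n, w n.+1 - w n <= C * w n.+1 ^+ 4 * expR (- w n.+1)) ->
  (forall n, k * expR (- w n.+1) <= w n.+1 - w n) ->
  exists2 K, 0 < K & forall n, K * n%:R <= expR (w n).
Proof.
move=> w0 C0 k0 H L.
pose B := C * (4 / 1) ^+ 4.
have DB n : w n.+1 - w n <= B.
  apply: le_trans (H n) _; rewrite /B -mulrA ler_wpM2l //.
  by have := pow4_expRN_le ltr01 (w0 n.+1); rewrite mul1r.
exists (k * expR (- B)); first by rewrite mulr_gt0 ?expR_gt0.
elim=> [|n IH]; first by rewrite mulr0 expR_ge0.
have G0 := expR_gt0 (w n).
have -> : expR (w n.+1) = expR (w n) * expR (w n.+1 - w n).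
  by rewrite -expRD; congr expR; ring.
have H1 := ler_wpM2l (ltW G0) (expR_ge1Dx (w n.+1 - w n)).
have H2 := ler_wpM2l (ltW G0) (L n).
have H3 : k * expR (- B) <= expR (w n) * (k * expR (- w n.+1)).
  rewrite mulrCA ler_pM2l // -expRD ler_expR; have := DB n; lra.
by rewrite -natr1; lra.
Qed.

Lemma ln_div_rate_cvg (R : realType) (w : nat -> R) :
  (exists2 K, 0 < K & forall n, K * n%:R <= expR (w n)) ->
  (forall theta, 0 < theta < 1 ->
    exists2 C, 0 < C & forall n, expR (theta * w n) <= C * n.+1%:R) ->
  (fun n => ln n%:R / w n) @ \oo --> (1 : R).
Proof.
move=> [K K0 HK] HC; apply/cvgrPdist_le => e e0.
(* With this theta, theta - (1 - e) = e^2 theta > 0. This slack, called [d], absorbs the constant ln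
   C + 1. *)
pose theta := 1 / (1 + e).
have e10 : 0 < 1 + e by lra.
have t01 : 0 < theta < 1.
  by rewrite divr_gt0 //= ltr_pdivrMr // mul1r; lra.
have [C C0 {}HC] := HC theta t01.
have tE : theta * (1 + e) = 1 by rewrite divfK // gt_eqF.
pose d := e ^+ 2 * theta.
have d0 : 0 < d by rewrite mulr_gt0 ?exprn_gt0 //; case/andP: t01.
(* Once w_n >= W, w_n is positive, |ln K| <= e w_n and |ln C + 1| <= d w_n; W is eventually passed
   because exp(w_n) >= K n. *)
pose W := 1 + `|ln K| / e + `|ln C + 1| / d.
have a1 : 0 <= `|ln K| / e by rewrite divr_ge0 // ltW.
have a2 : 0 <= `|ln C + 1| / d by rewrite divr_ge0 // ltW.
near=> n.
have n0 : (0 < n)%N by near: n; exact: nbhs_infty_gt.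
have nR : 1 <= n%:R :> R by rewrite ler1n.
have nR0 : 0 < n%:R :> R by rewrite ltr0n.
have Wn : W <= w n.
  rewrite -ler_expR; apply: le_trans (HK n).
  rewrite mulrC -ler_pdivrMr //; near: n; exact: nbhs_infty_ger.
have w0 : 0 < w n by apply: lt_le_trans Wn; rewrite /W; lra.
have lo : ln K + ln n%:R <= w n.
  by rewrite -lnM ?posrE // -[leRHS]expRK ler_ln ?posrE ?mulr_gt0 ?expR_gt0.
have hi : theta * w n <= ln C + (ln n%:R + 1).
  have : theta * w n <= ln (C * n.+1%:R).
    by rewrite -[leLHS]expRK ler_ln ?posrE ?mulr_gt0 ?expR_gt0.
  (* Writing n + 1 = n (1 + 1/n) gives ln(n + 1) <= ln n + 1. *)
  have -> : C * n.+1%:R = C * (n%:R * (1 + n%:R^-1)).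
    by rewrite mulrDr mulr1 mulfV ?gt_eqF // natr1.
  have i0 : 0 < n%:R^-1 :> R by rewrite invr_gt0.
  have i1 : n%:R^-1 <= 1 :> R by rewrite invf_le1.
  rewrite !lnM ?posrE ?mulr_gt0 //; try lra.
  have : ln (1 + n%:R^-1) <= n%:R^-1 :> R by apply: le_ln1Dx; lra.
  by lra.
have we : `|ln K| <= e * w n.
  by rewrite -ler_pdivrMl // mulrC; apply: le_trans Wn; rewrite /W; lra.
have wd : `|ln C + 1| <= d * w n.
  by rewrite -ler_pdivrMl // mulrC; apply: le_trans Wn; rewrite /W; lra.
have h1 := ler_norm (- ln K); rewrite normrN in h1.
have h2 := ler_norm (ln C + 1).
have tw : theta * w n = (1 - e) * w n + d * w n.
  have tE2 : e * (theta * (1 + e)) = e * 1 by rewrite tE.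
  have -> : theta = (1 - e) + d.
    by rewrite /d; clear -tE tE2; clearbody theta; move: tE tE2; lra.
  by ring.
have -> : 1 - ln n%:R / w n = (w n - ln n%:R) / w n by field; rewrite gt_eqF.
rewrite normrM normfV (gtr0_norm w0) ler_pdivrMr // ler_norml.
by apply/andP; split; lra.
Unshelve. all: by end_near. Qed.

(** * Comparison with the harmonic series, and removal of an r-th power *)

Lemma nneseries_odd_harmonic (R : realType) (u : nat -> R) (K : R) :
  0 < K -> (forall n, 0 <= u n) -> (forall n, K / n.+1%:R <= u n.*2.+1) ->
  (\sum_(0 <= n <oo) (u n)%:E)%E = +oo%E.
Proof.
move=> K0 u0 uK; apply: eq_infty => A.
have hd : series (@harmonic R) @ \oo --> +oo.
  apply: nondecreasing_dvgn_lt; last exact: dvg_harmonic.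
  apply/nondecreasing_seqP => n; rewrite /series /= big_nat_recr //= lerDl.
  by rewrite harmonic_ge0.
have [N _ /(_ N (leqnn N)) /= HN] := (cvgryPge _).1 hd (A / K).
have sumN M : K * series (@harmonic R) M <= \sum_(0 <= i < M.*2) u i.
  elim: M => [|M IH]; first by rewrite /series /= !big_geq // mulr0.
  rewrite doubleS !big_nat_recr //= {1}/series /= big_nat_recr //= mulrDr -addrA.
  by rewrite lerD // ler_wpDl.
apply: (@le_trans _ _ (\sum_(0 <= i < N.*2) (u i)%:E)%E).
  rewrite sumEFin lee_fin; apply: le_trans (sumN N).
  by rewrite mulrC -ler_pdivrMr.
by apply: nneseries_lim_ge => i _; rewrite lee_fin.
Qed.

(** Raising to a power moves a nonnegative number away from 1, so convergence of y^n to 1 passes to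
    y. *)
Lemma norm_sub1_expr (R : realType) (y : R) (n : nat) :
  (0 < n)%N -> 0 <= y -> `|1 - y| <= `|1 - y ^+ n|.
Proof.
case: n => // n _ y0; rewrite exprS.
have [y1|y1] := leP 1 y.
  have := exprn_ege1 n y1; move: (y ^+ n) => z z1.
  rewrite !ler0_norm; [nra|nra|lra].
have := exprn_ile1 n y0 (ltW y1); have := exprn_ge0 n y0.
move: (y ^+ n) => z z0 z1.
by rewrite !ger0_norm; [nra|nra|lra].
Qed.

(** * The orbit of alternating projections *)

Lemma scale_triple (R : realType) (a s y z : R) :
  a *: (s, y, z) = (a * s, a * y, a * z) :> R * R * R.
Proof. by []. Qed.

Lemma orbit_step (R : realType) (beta : R) (r : nat) (a b : R)
    (u v w : R * R * R) :
  0 < beta -> (1 < r)%N -> 0 < a -> 0 < b < 1 ->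
  b ^+ r * r.+1%:R <= beta * r%:R ->
  u = a *: (b, 0, 1) -> v = metric_proj (setK beta r) u ->
  w = metric_proj (setH R) v ->
  exists a' c, [/\ a <= a', 0 < c < b, c ^+ r * r.+1%:R <= beta * r%:R,
    v = a' *: (c, expo beta r c, 1) /\ w = a' *: (c, 0, 1) &
    expo beta r c * dexpo beta r c <= b - c <=
      2 * (expo beta r c * dexpo beta r c)].
Proof.
move=> be0 r1 a0 b01 br uE vE wE; have r0 := ltnW r1.
have [c cb E] := step_exists be0 r1 b01 br.
have /andP[c0 cb'] := cb; have /andP[b0 b1] := b01.
have cr : c ^+ r * r.+1%:R <= beta * r%:R.
  apply: le_trans br; rewrite ler_wpM2r // lerXn2r // ?nnegrE //; exact: ltW.
have [a' aa' pE] := metric_proj_setK be0 r0 a0 b0 c0 cr E.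
rewrite -uE -vE in pE; exists a', c; split=> //; last exact: step_bounds.
split=> //; by rewrite wE metric_proj_setH pE !scale_triple mulr0.
Qed.

(** Uniqueness lets the invariants of the constructed a_n, b_n pass to any a, b that represent the
    orbit. *)
Lemma scale_coneH_inj (R : realType) (a a' b b' : R) :
  0 < a -> a *: (b, 0, 1) = a' *: (b', 0, 1) :> R * R * R ->
  a' = a /\ b' = b.
Proof.
rewrite !scale_triple !mulr0 !mulr1 => a0 [ab aa']; split=> //.
by move: ab; rewrite -aa' => /mulfI; rewrite gt_eqF // => ->.
Qed.

Lemma expfun_fin_dom (R : realType) (beta : R) (r : nat) (b : R) :
  0 < beta -> (0 < r)%N -> 0 < b -> expfun beta r b \is a fin_num ->
  b ^+ r * r.+1%:R <= beta * r%:R.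
Proof.
move=> be0 r0 b0; rewrite /expfun gt_eqF //; case: ifPn => // + _.
by rewrite in_itv /= => /andP[_]; rewrite (le_dom_radius be0 r0 (ltW b0)).
Qed.

(** The domain condition survives because b decreases; the bound a >= a0 later keeps the step
    lengths from shrinking faster than f(b_n). *)
Lemma orbit_exists (R : realType) (beta : R) (r : nat) (a0 b0 : R)
    (x : nat -> R * R * R) :
  0 < beta -> (1 < r)%N -> 0 < a0 -> 0 < b0 < 1 ->
  b0 ^+ r * r.+1%:R <= beta * r%:R ->
  x 0%N = a0 *: (b0, 0, 1) ->
  (forall n : nat, x n.*2.+1 = metric_proj (setK beta r) (x n.*2)) ->
  (forall n : nat, x n.*2.+2 = metric_proj (setH R) (x n.*2.+1)) ->
  forall n, exists a b, [/\ a0 <= a, 0 < b < 1,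
    b ^+ r * r.+1%:R <= beta * r%:R & x n.*2 = a *: (b, 0, 1)].
Proof.
move=> be0 r1 a00 b01 br x0 xK xH; elim=> [|n [a [b [aa b01' br' xn]]]].
  by exists a0, b0.
have [a' [c [aa' cb cr [_ xE] _]]] :=
  orbit_step be0 r1 (lt_le_trans a00 aa) b01' br' xn (xK n) (xH n).
exists a', c; split=> //; first exact: le_trans aa'.
case/andP: cb => -> cb /=; case/andP: b01' => _; exact: lt_trans.
Qed.

Theorem mainTheorem4 (R : realType) (beta : R) (r : nat) (delta a0 b0 : R)
    (x : nat -> R * R * R)
    (hbeta : 0 < beta) (hr0 : (0 < r)%N) (hr : ~~ odd r)
    (hdelta : 0 < delta)
    (hdiff : forall t : R, 0 <= t <= delta -> ediff_at (expfun beta r) t)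
    (hb0 : 0 < b0 < Num.min 1 delta) (ha0 : 0 < a0)
    (hx0 : x 0%N = a0 *: (b0, 0, 1))
    (hxK : forall n : nat, x n.*2.+1 = metric_proj (setK beta r) (x n.*2))
    (hxH : forall n : nat, x n.*2.+2 = metric_proj (setH R) (x n.*2.+1)) :
  [/\ exists a b : nat -> R,
        forall n : nat, 0 < a n /\ x n.*2 = a n *: (b n, 0, 1),
      forall a b : nat -> R,
        (forall n : nat, 0 < a n /\ x n.*2 = a n *: (b n, 0, 1)) ->
        (fun n : nat => b n / ((2 * beta / ln n%:R) `^ (r%:R^-1)))
          @ \oo --> (1 : R)
    & forall gamma : R, 0 < gamma < 2 ->
        (\sum_(0 <= n <oo) (enorm (x n.+1 - x n) `^ gamma)%:E)%E = +oo%E].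
Proof.
have r1 : (1 < r)%N by case: r hr0 hr {hdiff hxK} => [|[]].
have /andP[b00] := hb0; rewrite lt_min => /andP[b01 b0d].
have b0dom : b0 ^+ r * r.+1%:R <= beta * r%:R.
  apply: expfun_fin_dom => //.
  (* As b0 < delta, differentiability makes f finite at b0, which puts b0 in the domain. *)
  have [fin_near _] : ediff_at (expfun beta r) b0 by apply: hdiff; rewrite !ltW.
  exact: nbhs_singleton fin_near.
have b001 : 0 < b0 < 1 by rewrite b00.
have ex := orbit_exists hbeta r1 ha0 b001 b0dom hx0 hxK hxH.
have exab : exists a b : nat -> R,
    forall n : nat, 0 < a n /\ x n.*2 = a n *: (b n, 0, 1).
  have [f fP] := choice ex; have [g gP] := choice fP.
  by exists f, g => n; have [fa _ _ xE] := gP n; rewrite (lt_le_trans ha0).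
have inv a b : (forall n : nat, 0 < a n /\ x n.*2 = a n *: (b n, 0, 1)) ->
    forall n, [/\ a0 <= a n, 0 < b n < 1 & b n ^+ r * r.+1%:R <= beta * r%:R].
  move=> H n; have [an xn] := H n.
  have [a' [b' [aa' b'01 b'r]]] := ex n.
  by rewrite xn => /(scale_coneH_inj an)[<- <-].
have step a b : (forall n : nat, 0 < a n /\ x n.*2 = a n *: (b n, 0, 1)) ->
    forall n, x n.*2.+1 = a n.+1 *: (b n.+1, expo beta r (b n.+1), 1) /\
      2 * beta ^+ 2 * r%:R ^+ 2 * expR (- rate beta r (b n.+1)) <=
      rate beta r (b n.+1) - rate beta r (b n) <=
      4 * beta ^+ 2 * r%:R ^+ 2 / (2 * beta) ^+ 4 * rate beta r (b n.+1) ^+ 4 *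
      expR (- rate beta r (b n.+1)).
  move=> H n; have [an xn] := H n; have [_ bn bnr] := inv _ _ H n.
  have [a' [c [aa' cb cr [vE wE] bnd]]] :=
    orbit_step hbeta r1 an bn bnr xn (hxK n) (hxH n).
  have [_ xn1] := H n.+1; rewrite doubleS wE in xn1.
  have a'0 : 0 < a' by exact: lt_le_trans aa'.
  have [-> ->] := scale_coneH_inj a'0 xn1; split=> //.
  by apply: rate_step => //; case/andP: bn.
have C0 : 0 <= 4 * beta ^+ 2 * r%:R ^+ 2 / (2 * beta) ^+ 4 :> R.
  by rewrite !mulr_ge0 ?invr_ge0 ?exprn_ge0 ?mulr_ge0 ?(ltW hbeta).
have k0 : 0 < 2 * beta ^+ 2 * r%:R ^+ 2 :> R.
  by rewrite !mulr_gt0 ?exprn_gt0 ?ltr0n.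
have rate0 a b : (forall n : nat, 0 < a n /\ x n.*2 = a n *: (b n, 0, 1)) ->
    forall n, 0 <= rate beta r (b n).
  move=> H n; have [_ /andP[bn _] _] := inv _ _ H n; exact: rate_ge0.
have upper a b : (forall n : nat, 0 < a n /\ x n.*2 = a n *: (b n, 0, 1)) ->
    forall theta, 0 < theta < 1 ->
    exists2 C1, 0 < C1 & forall n, expR (theta * rate beta r (b n)) <= C1 * n.+1%:R.
  move=> H theta t01; apply: expR_rate_upper (rate0 _ _ H) C0 t01 _ => n.
  by have [_ /andP[]] := step _ _ H n.
split=> //.
- move=> a b H; have rc := rate0 _ _ H.
  have lower : exists2 K, 0 < K & forall n, K * n%:R <= expR (rate beta r (b n)).
    by apply: expR_rate_lower rc C0 k0 _ _ => n; have [_ /andP[]] := step _ _ H n.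
  have /cvgrPdist_le cv := ln_div_rate_cvg lower (upper _ _ H).
  apply/cvgrPdist_le => e e0; near=> n.
  have n1 : (0 < n)%N by near: n; exact: nbhs_infty_gt.
  have [_ /andP[bn0 _] _] := inv _ _ H n.
  have l0 : 0 <= ln n%:R :> R by rewrite ln_ge0 // ler1n.
  have q0 : 0 <= 2 * beta / ln n%:R by rewrite divr_ge0 ?mulr_ge0 // ltW.
  have y0 : 0 <= b n / (2 * beta / ln n%:R) `^ r%:R^-1.
    by rewrite divr_ge0 ?powR_ge0 // ltW.
  (* The r-th power of the quotient is ln n / w_n, whose limit is known. *)
  apply: le_trans (norm_sub1_expr hr0 y0) _.
  have -> : (b n / (2 * beta / ln n%:R) `^ r%:R^-1) ^+ r =
      ln n%:R / rate beta r (b n).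
    rewrite expr_div_n -[X in _ / X]powR_mulrn ?powR_ge0 // -powRrM mulVf; last first.
      by rewrite pnatr_eq0 -lt0n.
    by rewrite powRr1 // invf_div /rate !invfM invrK; ring.
  near: n; exact: cv.
- move=> gamma /andP[g0 g2]; have [a [b H]] := exab.
  have t01 : 0 < gamma / 2 < 1 by apply/andP; split; lra.
  have [C1 C10 HC] := upper _ _ H _ t01.
  (* The term of index 2n+1 involves b_(n+1), whose bound is C1 (n + 2) <= 2 C1 (n + 1); hence the
     factor 2. *)
  have K0 : 0 < a0 `^ gamma / (2 * C1) by rewrite divr_gt0 ?powR_gt0 ?mulr_gt0.
  apply: nneseries_odd_harmonic K0 _ _ => n; first exact: powR_ge0.
  have [xodd _] := step _ _ H n; have [_ xev] := H n.+1.
  have [aa _ _] := inv _ _ H n.+1.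
  rewrite -doubleS xev xodd.
  have -> : enorm (a n.+1 *: (b n.+1, 0, 1) -
      a n.+1 *: (b n.+1, expo beta r (b n.+1), 1)) = a n.+1 * expo beta r (b n.+1).
    rewrite /enorm !scale_triple /= !subrr mulr0 sub0r sqrrN.
    rewrite expr0n /= add0r addr0 sqrtr_sqr ger0_norm // mulr_ge0 ?ltW ?expo_gt0 //.
    exact: lt_le_trans aa.
  rewrite powRM ?(ltW (expo_gt0 _ _ _)) ?(ltW (lt_le_trans ha0 aa)) // expo_powR.
  rewrite -mulrA -invfM; apply: ler_pM; rewrite ?powR_ge0 //.
  - by rewrite invr_ge0 !mulr_ge0 // ltW.
  - by apply: ge0_ler_powR => //; rewrite ?nnegrE ltW // (lt_le_trans ha0).
  rewrite expRN lef_pV2 ?posrE ?expR_gt0 ?mulr_gt0 ?ltr0n //.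
  apply: le_trans (HC n.+1) _; rewrite mulrAC mulrC ler_pM2r //.
  by rewrite -natrM ler_nat mul2n doubleS !ltnS -addnn leq_addr.
Unshelve. all: by end_near. Qed.
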